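(* Fix $\widehat u=(\widehat u_-,\widehat u_+)\in\mathbb{C}^2$ (with the possibility $\widehat u_-=0$ or $\widehat u_+=0$ allowed), and consider system (S) with $u=\lambda\widehat u$. Define $$\widehat r:=\frac{1}{|1+i\alpha|}\begin{bmatrix}|\widehat u_-|\\ |\widehat u_+|\end{bmatrix}\in[0,\infty)\times[0,\infty),$$ let $\phi_\pm\in\mathbb{R}$ be numbers such that $\widehat u_\pm=|\widehat u_\pm|e^{i\phi_\pm}$, and let $\theta:=-\arg(1+i\alpha)$. Fix $j\in\mathcal J$. Suppose $I\subset\mathbb{R}$ is an interval containing the origin and $$h=(h_1,h_2):I\to\{x\in\mathbb{R}^2:\det D_xF_{\widehat r}(x)\neq 0\}$$ is a solution to the initial value problem $$\dot h(s)=\big[D_xF_{\widehat r}(h(s))\big]^{-1}\widehat r,\qquad h(0)=x^{(j)}.$$ Then for every $\lambda\in\mathbb{C}\setminus\{0\}$ such that $|\lambda|\in I$, the triple $(E(\lambda),N(\lambda),n(\lambda))$ defined by $$E(\lambda):=e^{i\theta}\frac{\lambda}{|\lambda|}\begin{bmatrix}h_1(|\lambda|)\,e^{i\phi_-}\\ h_2(|\lambda|)\,e^{i\phi_+}\end{bmatrix}\quad\text{and}\quad\begin{bmatrix}N(\lambda)\\ n(\lambda)\end{bmatrix}:=y(h(|\lambda|))$$ is an equilibrium point of system (S) with injected field $u=\lambda\widehat u$.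
   Context: Fixed real parameters: $\kappa,\gamma,\delta\in(0,\infty)$, $\alpha\in\mathbb{R}$, $\mu>1$. For $z=(z_1,z_2)\in\mathbb{C}^2$ define $$X(z):=\begin{bmatrix}1-(z_1-z_2)&0\\0&1-(z_1+z_2)\end{bmatrix},\qquad Y(z):=\begin{bmatrix}1+|z|^2&|z_2|^2-|z_1|^2\\ |z_2|^2-|z_1|^2&\delta+|z|^2\end{bmatrix}.$$ For a constant $u=(u_-,u_+)\in\mathbb{C}^2$, system (S) is the following system of ODEs for $E(t)=(E_-(t),E_+(t))\in\mathbb{C}^2$ and $N(t),n(t)\in\mathbb{R}$: $$\frac{d}{dt}E=-\kappa\big((1+i\alpha)X(N,n)E-u\big),\qquad \frac{d}{dt}\begin{bmatrix}N\\ n\end{bmatrix}=-\gamma\Big(Y(E)\begin{bmatrix}N\\ n\end{bmatrix}-\begin{bmatrix}\mu\\0\end{bmatrix}\Big).\tag{S}$$ An equilibrium point of (S) is a triple $(E,N,n)\in\mathbb{C}^2\times\mathbb{R}\times\mathbb{R}$ at which both right-hand sides vanish. The function $y:\mathbb{R}^2\to\mathbb{R}^2$ is $y(x):=Y(x)^{-1}(\mu,0)^T$ (note $\det Y(x)=\delta+(1+\delta)|x|^2+4x_1^2x_2^2>0$). For $s\in\mathbb{R}$, $x\in\mathbb{R}^2$ let $F_{\widehat r}(s,x):=X(y(x))x-s\widehat r$, and let $D_xF_{\widehat r}(x)$ be the $2\times2$ Jacobian matrix of $F_{\widehat r}$ with respect to $x$ (it does not depend on $s$). The index set is $\mathcal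 J:=\{0,\pm\mathrm{L},\pm\mathrm{R},\pm\mathrm{X},\pm\mathrm{Y}\}$, and $$x^{(0)}:=\begin{bmatrix}0\\0\end{bmatrix},\quad x^{(\pm\mathrm L)}:=\pm\sqrt{\tfrac{\delta(\mu-1)}{1+\delta}}\begin{bmatrix}1\\0\end{bmatrix},\quad x^{(\pm\mathrm R)}:=\pm\sqrt{\tfrac{\delta(\mu-1)}{1+\delta}}\begin{bmatrix}0\\1\end{bmatrix},$$ $$x^{(\pm\mathrm X)}:=\pm\sqrt{\tfrac{\mu-1}{2}}\begin{bmatrix}1\\1\end{bmatrix},\quad x^{(\pm\mathrm Y)}:=\pm\sqrt{\tfrac{\mu-1}{2}}\begin{bmatrix}1\\-1\end{bmatrix}.$$ *)

(* Defs.v *)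
From mathcomp Require Export all_boot all_order all_algebra.
From mathcomp Require Export all_classical all_reals all_analysis.
From mathcomp Require Export complex.

Set Implicit Arguments.
Unset Strict Implicit.
Unset Printing Implicit Defensive.

Import Order.TTheory GRing.Theory Num.Theory.
Import numFieldNormedType.Exports.

Local Open Scope classical_set_scope.
Local Open Scope ring_scope.
Local Open Scope complex_scope.

(* A pair (z_1, z_2) is a column vector z, with z_1 = z 0 0 and z_2 = z 1 0;
   for pairs (z_-, z_+) the minus component comes first. *)
Definition col2 (K : Type) (a b : K) : 'cV[K]_2 :=
  \col_(i < 2) if i == 0 then a else b.

Definition mat2 (K : Type) (a b c d : K) : 'M[K]_2 :=
  \matrix_(i < 2, j < 2)
    if i == 0 then (if j == 0 then a else b) else (if j == 0 then c else d).

Definition cabs (R : realType) (z : R[i]) : R := ComplexField.Normc.normc z.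

Definition expi (R : realType) (t : R) : R[i] := cos t +i* sin t.

(* Principal argument, in ]-pi, pi]; at z = 0 every t qualifies and the value
   is unspecified. *)
Definition carg (R : realType) (z : R[i]) : R :=
  xget 0 [set t : R | - pi < t <= pi /\ z = (cabs z)%:C * expi t].

Definition csqnorm (R : realType) (z : 'cV[R[i]]_2) : R :=
  cabs (z 0 0) ^+ 2 + cabs (z 1 0) ^+ 2.

(* Stated over a generic ring K because X is applied both to complex vectors
   (K = R[i]) and, with a real matrix as value, to real ones (K = R). *)
Definition X (K : nzRingType) (z : 'cV[K]_2) : 'M[K]_2 :=
  mat2 (1 - (z 0 0 - z 1 0)) 0
       0                     (1 - (z 0 0 + z 1 0)).

Definition Y (R : realType) (delta : R) (z : 'cV[R[i]]_2) : 'M[R]_2 :=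
  let d := cabs (z 1 0) ^+ 2 - cabs (z 0 0) ^+ 2 in
  mat2 (1 + csqnorm z) d
       d               (delta + csqnorm z).

Definition cvec (R : realType) (x : 'cV[R]_2) : 'cV[R[i]]_2 :=
  map_mx (real_complex R) x.

(* The system is dE/dt = rhsE, d(N, n)/dt = rhsNn, with E complex and N, n real. *)
Definition rhsE (R : realType) (kappa alpha : R) (u E : 'cV[R[i]]_2) (N n : R) :
    'cV[R[i]]_2 :=
  - (kappa%:C *:
      (((1 +i* alpha) *: (X (cvec (col2 N n)) *m E)) - u)).

Definition rhsNn (R : realType) (gamma delta mu : R) (E : 'cV[R[i]]_2) (N n : R) :
    'cV[R]_2 :=
  - (gamma *: (Y delta E *m col2 N n - col2 mu 0)).

Definition equilibrium (R : realType) (kappa gamma delta alpha mu : R)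
    (u E : 'cV[R[i]]_2) (N n : R) : Prop :=
  rhsE kappa alpha u E N n = 0 /\ rhsNn gamma delta mu E N n = 0.

Definition y (R : realType) (delta mu : R) (x : 'cV[R]_2) : 'cV[R]_2 :=
  invmx (Y delta (cvec x)) *m col2 mu 0.

Definition F (R : realType) (delta mu : R) (r : 'cV[R]_2) (s : R)
    (x : 'cV[R]_2) : 'cV[R]_2 :=
  X (y delta mu x) *m x - s *: r.

(* The library's ['J f p] acts on row vectors; this is the matrix of partial
   derivatives (row i : component i of f), acting on column vectors. *)
Definition jacobian_col (R : realType) (f : 'cV[R]_2 -> 'cV[R]_2)
    (x : 'cV[R]_2) : 'M[R]_2 :=
  \matrix_(i < 2, j < 2)
    'D_(delta_mx j 0 : 'cV[R]_2) (fun v : 'cV[R]_2 => f v i 0) x.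

(* Taken at s = 0; see [DxF_indep]. *)
Definition DxF (R : realType) (delta mu : R) (r : 'cV[R]_2) (x : 'cV[R]_2) :
    'M[R]_2 :=
  jacobian_col (F delta mu r 0) x.

Lemma DxF_indep (R : realType) (delta mu : R) (r : 'cV[R]_2) (s : R)
    (x : 'cV[R]_2) :
  jacobian_col (F delta mu r s) x = DxF delta mu r x.
Proof.
apply/matrixP => i j; rewrite !mxE /derive.
set g := fun t : R => _; set g' := fun t : R => _.
suff -> : g = g' by [].
apply/funext => t; rewrite /g /g' /= /F scale0r subr0; congr (_ *: _).
rewrite [X in X - _ = _]mxE [X in _ - X = _]mxE opprD addrACA subrr addr0.
by rewrite subr0.
Qed.

Inductive branch : Set :=
  | J0 | JLp | JLm | JRp | JRm | JXp | JXm | JYp | JYm.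

Definition xpt (R : realType) (delta mu : R) (j : branch) : 'cV[R]_2 :=
  let a := Num.sqrt (delta * (mu - 1) / (1 + delta)) in
  let b := Num.sqrt ((mu - 1) / 2) in
  match j with
  | J0 => 0
  | JLp => a *: col2 1 0
  | JLm => - (a *: col2 1 0)
  | JRp => a *: col2 0 1
  | JRm => - (a *: col2 0 1)
  | JXp => b *: col2 1 1
  | JXm => - (b *: col2 1 1)
  | JYp => b *: col2 1 (-1)
  | JYm => - (b *: col2 1 (-1))
  end.

(* Derivative of h at s relative to I: one-sided at an endpoint of I. *)
Definition is_derive_within (R : realType) (I : set R) (h : R -> 'cV[R]_2)
    (s : R) (v : 'cV[R]_2) : Prop :=
  (t - s)^-1 *: (h t - h s) @[t --> within I s^'] --> v.

(* h, of which only the values on I matter, maps I into {det DxF <> 0} and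
   solves h' = DxF(h)^-1 r on I with h(0) = x0. *)
Definition ivp_solution (R : realType) (delta mu : R) (r x0 : 'cV[R]_2)
    (I : set R) (h : R -> 'cV[R]_2) : Prop :=
  [/\ forall s, I s -> \det (DxF delta mu r (h s)) != 0,
      forall s, I s ->
        is_derive_within I h s (invmx (DxF delta mu r (h s)) *m r)
    & h 0 = x0].

Definition rhat (R : realType) (alpha : R) (uhat : 'cV[R[i]]_2) : 'cV[R]_2 :=
  (cabs (1 +i* alpha))^-1 *: col2 (cabs (uhat 0 0)) (cabs (uhat 1 0)).

(* Main.v *)
Require Import Defs.
From mathcomp Require Import ring lra.
Import Order.TTheory GRing.Theory Num.Theory.
Import numFieldNormedType.Exports.
Local Open Scope classical_set_scope.
Local Open Scope ring_scope.
Local Open Scope complex_scope.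

Set Implicit Arguments.
Unset Strict Implicit.
Unset Printing Implicit Defensive.

(** The differential equation is the one satisfied by a curve along which [F]
    stays zero: multiplying [h' = DxF(h)^-1 r] by [DxF(h)] shows that
    [F 0 (h s) - s r] has derivative zero on [I].  Hence [F s (h s)] keeps the
    value it has at [s = 0], and that value is zero because each of the nine
    points [xpt j] solves [X(y(x)) x = 0] (lemma [F_xpt]).

    So at [rho = |lambda|] the real system [X(y(x)) x = rho r] holds with
    [x = h rho].  The phases are then restored by hand: [Y] depends on the
    moduli of the components of the field only, so that [(N, n) = y(x)] solves
    the second equation whatever the phases are, and [X] is diagonal, so that
    the first equation splits into two scalar ones, in which the factor
    [exp(i theta)] turns [1 + i alpha] into its modulus, which in turn cancels
    the one in the definition of [rhat] (lemma [equilibrium_of_F_eq0]).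

    The conservation argument, [comp_solution_affine], needs care in two
    places.  The derivative of [h] is only relative to [I], and one-sided at the
    endpoints of [I]; the mean value theorem asks for no more than continuity
    there.  The Jacobian matrix collects partial derivatives, and these
    determine the derivative of a composition only for a differentiable
    function; [F] is one, being rational in [x] with a denominator, [det Y],
    that is positive everywhere. *)

(** * Derivatives relative to an interval *)

(** A difference quotient with a limit forces continuity: [h t - h s] is
    [t - s] times the quotient. *)
Lemma is_derive_within_cvg (R : realType) (I : set R) (h : R -> 'cV[R]_2)
    (s : R) (v : 'cV[R]_2) :
  is_derive_within I h s v -> h t @[t --> within I s^'] --> h s.
Proof.
move=> hv.
have st : (t - s) @[t --> within I s^'] --> (0 : R).
  have ss : t @[t --> s^'] --> s by move=> P; exact: nbhs_dnbhs.
  have st0 : (t - s) @[t --> s^'] --> s - s by exact: (cvgB ss (cvg_cst s)).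
  by rewrite subrr in st0; exact: (cvg_within_filter _ st0).
have kh : ((t - s) *: ((t - s)^-1 *: (h t - h s)) + h s)
    @[t --> within I s^'] --> h s.
  have H := cvgD (cvgZ st hv) (cvg_cst (h s)).
  by rewrite scale0r add0r in H; exact: H.
refine (cvg_trans (near_eq_cvg _) kh).
rewrite near_withinE.
have : \forall t \near s^', t != s by exact: nbhs_dnbhs_neq.
apply: filterS => t ts _ /=.
by rewrite scalerA divff ?subr_eq0// scale1r subrK.
Qed.

Lemma is_derive_within_interior (R : realType) (I : set R) (h : R -> 'cV[R]_2)
    (s : R) (v : 'cV[R]_2) :
  nbhs s I -> is_derive_within I h s v -> is_derive s 1 h v.
Proof.
move=> Is hv.
have shift_cvg : (e *: 1 + s) @[e --> (0 : R)^'] --> within I s^'.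
  move=> P; rewrite /within /= => /nbhs_ballP[e /= e0 eP].
  have [d /= d0 dI] := (iffLR (nbhs_ballP _ _)) Is.
  apply/nbhs_ballP; exists (Num.min e d); first by rewrite /= lt_min e0.
  move=> t; rewrite /ball /= sub0r normrN lt_min => /andP[te td] t0.
  have sE : s - (t%:A + s) = - t.
    by rewrite [t%:A]mulr1 opprD addrCA subrr addr0.
  apply: eP; rewrite /ball /= ?sE ?normrN//.
    by rewrite -subr_eq0 addrK [t%:A]mulr1.
  by apply: dI; rewrite /ball /= sE normrN.
have dq : e^-1 *: ((h \o shift s) (e *: 1) - h s) @[e --> (0 : R)^'] --> v.
  refine (cvg_trans (near_eq_cvg _) (cvg_comp _ _ shift_cvg hv)).
  by near=> e; rewrite /= addrK [e%:A]mulr1.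
split; first by apply/cvg_ex; exists v.
exact: cvg_lim.
Unshelve. all: by end_near. Qed.

(** By linearity of the differential, which is where differentiability is used:
    the mere existence of partial derivatives gives no linear approximation. *)
Lemma diff_jacobian_col (R : realType) (f : 'cV[R]_2 -> 'cV[R]_2)
    (x v : 'cV[R]_2) (i : 'I_2) :
  differentiable (fun w : 'cV[R]_2 => f w i 0) x ->
  'd (fun w : 'cV[R]_2 => f w i 0) x v = (jacobian_col f x *m v) i 0.
Proof.
move=> df; rewrite {1}[v]matrix_sum_delta raddf_sum mxE.
apply: eq_bigr => j _; rewrite big_ord1 mxE deriveE//.
by rewrite mulrC; exact: (linearZ_LR ('d _ x : {linear _ -> _})).
Qed.

Lemma cvg_at_right_of_within (R : realType) (T : topologicalType) (I : set R)
    (f : R -> T) (l : T) (a b : R) : a < b -> `]a, b[ `<=` I ->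
  f t @[t --> within I a^'] --> l -> f t @[t --> a^'+] --> l.
Proof.
move=> ab abI fl P Pl; have PI : within I a^' (f @^-1` P) := fl P Pl.
have Pnear : \forall t \near a, t != a -> I t -> P (f t) := PI.
apply: (_ : a^'+ (f @^-1` P)); near=> t.
have : t != a -> I t -> P (f t) by near: t; apply: filterS Pnear => t + _.
apply; [by rewrite gt_eqF| apply: abI].
by rewrite /= in_itv /=; apply/andP; split.
Unshelve. all: by end_near. Qed.

Lemma cvg_at_left_of_within (R : realType) (T : topologicalType) (I : set R)
    (f : R -> T) (l : T) (a b : R) : a < b -> `]a, b[ `<=` I ->
  f t @[t --> within I b^'] --> l -> f t @[t --> b^'-] --> l.
Proof.
move=> ab abI fl P Pl; have PI : within I b^' (f @^-1` P) := fl P Pl.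
have Pnear : \forall t \near b, t != b -> I t -> P (f t) := PI.
apply: (_ : b^'- (f @^-1` P)); near=> t.
have : t != b -> I t -> P (f t) by near: t; apply: filterS Pnear => t + _.
apply; [by rewrite lt_eqF| apply: abI].
by rewrite /= in_itv /=; apply/andP; split.
Unshelve. all: by end_near. Qed.

(** Componentwise, the derivative of [f \o h] at an interior point is row [i] of
    [J (J^-1 r)], that is [r i], so the mean value theorem gives the increment
    exactly.  At the endpoints [a] and [b], which may be endpoints of [I], only
    continuity relative to [I] is available, and it suffices. *)
Lemma comp_solution_affine (R : realType) (f : 'cV[R]_2 -> 'cV[R]_2)
    (r : 'cV[R]_2) (I : set R) (h : R -> 'cV[R]_2) (a b : R) :
  is_interval I -> I a -> I b -> a < b ->
  (forall x i, differentiable (fun w : 'cV[R]_2 => f w i 0) x) ->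
  (forall s, I s -> \det (jacobian_col f (h s)) != 0) ->
  (forall s, I s ->
    is_derive_within I h s (invmx (jacobian_col f (h s)) *m r)) ->
  f (h b) = f (h a) + (b - a) *: r.
Proof.
move=> itvI Ia Ib ab df detN0 dh.
have abI : `]a, b[ `<=` I.
  move=> t; rewrite /= in_itv /= => /andP[at_ tb].
  by apply: (itvI a b) => //; rewrite !ltW.
apply/matrixP => i k; rewrite ord1 !mxE {k}.
pose g t := f (h t) i 0.
have gE : g = (fun w : 'cV[R]_2 => f w i 0) \o h by [].
have dg s : s \in `]a, b[%R -> is_derive s 1 g (r i 0).
  move=> sab; have Is : I s by exact: abI.
  have sI : nbhs s I.
    by apply: (filterS abI); apply: near_in_itvoo.
  have hs := is_derive_within_interior sI (dh s Is).
  have dhs : differentiable h s by apply/derivable1_diffP; case: hs.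
  have dgs : differentiable g s by rewrite gE; exact: differentiable_comp.
  split; first exact/derivable1_diffP.
  rewrite deriveE// gE diff_comp//= -(deriveE _ dhs).
  rewrite (@derive_val _ _ _ _ _ _ _ hs) diff_jacobian_col//.
  by rewrite mulKVmx// unitmxE unitfE detN0.
have gc s : I s -> g t @[t --> within I s^'] --> g s.
  move=> Is; have fc := differentiable_continuous (df (h s) i).
  exact: (cvg_comp _ _ (is_derive_within_cvg (dh s Is)) fc).
have [|c _] := @MVT R g (fun=> r i 0) a b ab dg.
  apply/continuous_within_itvP => //; split.
  - move=> s /dg[+ _] => /derivable1_diffP; exact: differentiable_continuous.
  - exact: cvg_at_right_of_within ab abI (gc a Ia).
  - exact: cvg_at_left_of_within ab abI (gc b Ib).
by rewrite /g mulrC => <-; rewrite addrC subrK.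
Qed.

(** * Moduli and phases *)

Lemma sqr_cabs_real (R : realType) (t : R) : cabs t%:C ^+ 2 = t ^+ 2.
Proof. by rewrite /cabs /= expr0n /= addr0 sqr_sqrtr ?sqr_ge0. Qed.

Lemma cabs_expi (R : realType) (t : R) : cabs (expi t) = 1.
Proof. by rewrite /cabs /= cos2Dsin2 sqrtr1. Qed.

Lemma cabs_eq0 (R : realType) (z : R[i]) : (cabs z == 0) = (z == 0).
Proof.
apply/eqP/eqP => [/ComplexField.Normc.eq0_normc//|->].
exact: ComplexField.Normc.normc0.
Qed.

Lemma expiN (R : realType) (t : R) : expi (- t) * expi t = 1.
Proof.
rewrite /expi cosN sinN; apply/eqP; rewrite eq_complex /=.
rewrite mulNr opprK -!expr2 cos2Dsin2 eqxx /= mulNr mulrC subrr.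
by rewrite eqxx.
Qed.

(** The value of [carg] is specified only when a principal argument exists; for
    a number with real part 1 the arctangent of its imaginary part is one. *)
Lemma carg_polar (R : realType) (alpha : R) :
  1 +i* alpha = (cabs (1 +i* alpha))%:C * expi (carg (1 +i* alpha)).
Proof.
rewrite /carg; set P := [set t | _]; suff : P (xget 0 P) by case.
apply: xgetPex.
have pi0 := pi_gt0 R; have pi2 : pi / 2 <= pi :> R by lra.
have sq : 1 +i* alpha = (Num.sqrt (1 + alpha ^+ 2))%:C * expi (atan alpha).
  have cE := cos_atan alpha.
  have D0 : 0 < Num.sqrt (1 + alpha ^+ 2).
    by rewrite sqrtr_gt0 ltr_pwDl ?sqr_ge0.
  have c0 : cos (atan alpha) != 0 by rewrite cE invr_eq0 gt_eqF.
  have sE : sin (atan alpha) = alpha * cos (atan alpha).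
    by rewrite -[X in _ = X * _](atanK alpha) /tan divfK.
  apply/eqP; rewrite eq_complex /= !mul0r subr0 addr0 sE cE.
  by rewrite mulrCA !(divff _, mulr1) ?eqxx ?gt_eqF.
exists (atan alpha) => /=; split; last by rewrite /cabs /= expr1n.
rewrite (lt_trans _ (atan_gtNpi2 alpha)) ?ltrN2; last by lra.
by rewrite (le_trans (ltW (atan_ltpi2 alpha))).
Qed.

(** * Closed form and regularity of F *)

Lemma col2_eta (K : Type) (x : 'cV[K]_2) : x = col2 (x 0 0) (x 1 0).
Proof.
apply/matrixP => i k; rewrite ord1 !mxE; case: ifPn => [/eqP->//|i0].
congr (x _ _); apply/val_inj; move: i i0 => [[|[|]]]//.
Qed.

Lemma mul_mat2_col2 (K : nzRingType) (a b c d e f : K) :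
  mat2 a b c d *m col2 e f = col2 (a * e + b * f) (c * e + d * f).
Proof.
apply/matrixP => i k; rewrite !mxE !big_ord_recl big_ord0 !mxE /= addr0.
by case: ifP.
Qed.

(** The determinant of [Y delta (cvec x)], expanded as a sum of terms that are
    visibly nonnegative. *)
Definition Yden (R : realType) (delta : R) (x : 'cV[R]_2) : R :=
  delta + (1 + delta) * (x 0 0 ^+ 2 + x 1 0 ^+ 2) + 4 * x 0 0 ^+ 2 * x 1 0 ^+ 2.

Lemma Yden_gt0 (R : realType) (delta : R) (x : 'cV[R]_2) :
  0 < delta -> 0 < Yden delta x.
Proof.
move=> d0; apply: (lt_le_trans d0); rewrite /Yden -addrA lerDl addr_ge0//.
  by rewrite mulr_ge0// addr_ge0 ?sqr_ge0 ?ler01 ?(ltW d0).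
by rewrite -mulrA -exprMn mulr_ge0 ?sqr_ge0.
Qed.

Lemma Y_cvec (R : realType) (delta : R) (x : 'cV[R]_2) :
  Y delta (cvec x) =
    mat2 (1 + (x 0 0 ^+ 2 + x 1 0 ^+ 2)) (x 1 0 ^+ 2 - x 0 0 ^+ 2)
         (x 1 0 ^+ 2 - x 0 0 ^+ 2) (delta + (x 0 0 ^+ 2 + x 1 0 ^+ 2)).
Proof. by rewrite /Y /csqnorm !mxE !sqr_cabs_real. Qed.

Lemma Y_unit (R : realType) (delta : R) (x : 'cV[R]_2) :
  0 < delta -> Y delta (cvec x) \in unitmx.
Proof.
move=> /(Yden_gt0 x)/gt_eqF d0.
rewrite unitmxE unitfE (expand_det_row _ 0) !big_ord_recl big_ord0 /cofactor.
rewrite !det_mx11 Y_cvec !mxE /= addr0.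
rewrite [X in X != _](_ : _ = Yden delta x) ?d0// /Yden.
by rewrite expr0 /bump /= expr1; ring.
Qed.

Lemma Y_y (R : realType) (delta mu : R) (x : 'cV[R]_2) :
  0 < delta -> Y delta (cvec x) *m y delta mu x = col2 mu 0.
Proof. by move=> d0; rewrite /y mulKVmx// Y_unit. Qed.

(** Cramer's rule for the system [Y y = (mu, 0)]. *)
Lemma yE (R : realType) (delta mu : R) (x : 'cV[R]_2) : 0 < delta ->
  y delta mu x =
    col2 (mu * (delta + (x 0 0 ^+ 2 + x 1 0 ^+ 2)) / Yden delta x)
         (mu * (x 0 0 ^+ 2 - x 1 0 ^+ 2) / Yden delta x).
Proof.
move=> d0; rewrite /y -[LHS]/(_ *m _); apply: (canLR (mulKmx (Y_unit x d0))).
have /lt0r_neq0 D0 := Yden_gt0 x d0.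
rewrite Y_cvec mul_mat2_col2; congr col2.
  by apply: (mulIf D0); rewrite mulrDl !mulrA !divfK// /Yden; ring.
by apply: (mulIf D0); rewrite mulrDl !mulrA !divfK// /Yden; ring.
Qed.

(** The entries [1 - (N - n)] and [1 - (N + n)] of [X] combine with [yE] so that
    the saturation of each component involves the square of the other one. *)
Lemma FE (R : realType) (delta mu : R) (r : 'cV[R]_2) (s : R) (x : 'cV[R]_2) :
  0 < delta ->
  F delta mu r s x =
    col2 (x 0 0 * (1 - mu * (delta + 2 * x 1 0 ^+ 2) / Yden delta x))
         (x 1 0 * (1 - mu * (delta + 2 * x 0 0 ^+ 2) / Yden delta x)) - s *: r.
Proof.
move=> d0; rewrite /F /X yE// [Z in _ *m Z](col2_eta x) mul_mat2_col2 !mxE /=.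
by congr (col2 _ _ - _); rewrite mul0r ?(addr0, add0r); ring.
Qed.

(** [F] is rational in [x], and [Yden] has no zero. *)
Lemma differentiable_F (R : realType) (delta mu : R) (r : 'cV[R]_2) (s : R)
    (x : 'cV[R]_2) (i : 'I_2) : 0 < delta ->
  differentiable (fun w : 'cV[R]_2 => F delta mu r s w i 0) x.
Proof.
move=> d0.
pose p k := fun w : 'cV[R]_2 => w k 0 : R.
pose q k := p k * p k.
have dp k : differentiable (p k) x by exact: differentiable_coord.
have dq k : differentiable (q k) x by exact: differentiableM.
have dc (c : R) : differentiable (cst c : 'cV[R]_2 -> R) x.
  exact: differentiable_cst.
have YdenE : @Yden R delta =
    cst delta + cst (1 + delta) * (q 0 + q 1) + cst 4 * q 0 * q 1.
  by apply/funext => w; rewrite /Yden !fctE /q !fctE /p /=; ring.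
have dY : differentiable (@Yden R delta) x.
  rewrite YdenE.
  exact: (differentiableD
    (differentiableD (dc _)
      (differentiableM (dc _) (differentiableD (dq 0) (dq 1))))
    (differentiableM (differentiableM (dc _) (dq 0)) (dq 1))).
have dYV : differentiable (fun w => (Yden delta w)^-1) x.
  exact: differentiableV dY (lt0r_neq0 (Yden_gt0 x d0)).
have -> : (fun w : 'cV[R]_2 => F delta mu r s w i 0) =
    p i * (cst 1 - cst mu *
      (cst delta + cst 2 * q (if i == 0 then 1 else 0)) *
        (fun w => (Yden delta w)^-1)) - cst (s * r i 0).
  apply/funext => w; rewrite FE// !mxE !fctE /q !fctE /p /=.
  have [->|i0] := eqVneq i 0; first by rewrite expr2.
  have -> : i = 1 by apply/val_inj; move: i i0 => [[|[|]]].
  by rewrite expr2.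
exact: (differentiableB (differentiableM (dp i)
  (differentiableB (dc _) (differentiableM (differentiableM (dc _)
    (differentiableD (dc _) (differentiableM (dc _) (dq _)))) dYV))) (dc _)).
Qed.

(** Each component of [F] vanishes for one of two reasons: the coordinate
    in front is zero, or the saturation factor is, which for the points other
    than the origin is what fixes the constants under the square roots. *)
Lemma F_xpt (R : realType) (delta mu : R) (r : 'cV[R]_2) (j : branch) :
  0 < delta -> 1 < mu -> F delta mu r 0 (xpt delta mu j) = 0.
Proof.
move=> d0 mu1; rewrite FE// scale0r subr0.
have D0 := lt0r_neq0 (Yden_gt0 (xpt delta mu j) d0).
have factor0 (c t D : R) : D != 0 -> c = 0 \/ t = D -> c * (1 - t / D) = 0.
  by move=> ? [->|->]; rewrite ?mul0r// divff// subrr mulr0.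
set a := Num.sqrt (delta * (mu - 1) / (1 + delta)).
set b := Num.sqrt ((mu - 1) / 2).
have dn0 : 1 + delta != 0 by apply: lt0r_neq0; lra.
have a2 : a ^+ 2 = delta * (mu - 1) / (1 + delta).
  by rewrite sqr_sqrtr// divr_ge0 ?mulr_ge0; lra.
have b2 : b ^+ 2 = (mu - 1) / 2 by rewrite sqr_sqrtr//; lra.
set x := xpt delta mu j in D0 *.
suff [-> ->] :
    x 0 0 * (1 - mu * (delta + 2 * x 1 0 ^+ 2) / Yden delta x) = 0 /\
    x 1 0 * (1 - mu * (delta + 2 * x 0 0 ^+ 2) / Yden delta x) = 0.
  by apply/matrixP => i k; rewrite !mxE if_same.
by rewrite {}/x in D0 *; case: j D0 => /= D0; rewrite -?/a -?/b;
  split; apply: factor0 => //;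
  rewrite ?/Yden !mxE /= ?(mulr0, mulr1, mulrN1, oppr0); (by left) || right;
  rewrite ?sqrrN ?expr0n /= ?a2 ?b2; field.
Qed.

(** * From zeros of F to equilibria *)

(** A real zero of [F] becomes an equilibrium once each component carries the
    phase of the corresponding injected one.  The common factor [w] is the phase
    of [lambda], and [exp(- i carg(1 + i alpha))] compensates the argument of
    [1 + i alpha]. *)
Lemma equilibrium_of_F_eq0 (R : realType) (kappa gamma delta alpha mu : R)
    (uhat : 'cV[R[i]]_2) (phim phip rho : R) (w : R[i]) (x : 'cV[R]_2) :
  0 < delta ->
  uhat 0 0 = (cabs (uhat 0 0))%:C * expi phim ->
  uhat 1 0 = (cabs (uhat 1 0))%:C * expi phip ->
  cabs w = 1 ->
  F delta mu (rhat alpha uhat) rho x = 0 ->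
  equilibrium kappa gamma delta alpha mu ((rho%:C * w) *: uhat)
    ((expi (- carg (1 +i* alpha)) * w) *:
      col2 ((x 0 0)%:C * expi phim) ((x 1 0)%:C * expi phip))
    (y delta mu x 0 0) (y delta mu x 1 0).
Proof.
move=> d0 um up w1 F0; split; last first.
  set E := _ *: col2 _ _.
  have YE : Y delta E = Y delta (cvec x).
    have nE k t : cabs (expi (- carg (1 +i* alpha)) * w *
        ((x k 0)%:C * expi t)) ^+ 2 = cabs (cvec x k 0) ^+ 2.
      rewrite /cabs !ComplexField.Normc.normcM -!/(cabs _) w1 !cabs_expi !mxE.
      by rewrite mulr1 !mul1r mulr1.
    by rewrite /Y /csqnorm !mxE /= !nE !mxE.
  by rewrite /rhsNn YE -col2_eta Y_y// subrr scaler0 oppr0.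
rewrite /rhsE -col2_eta.
set z := 1 +i* alpha.
have z0 : cabs z != 0 by rewrite cabs_eq0 eq_complex /= oner_eq0.
have ze : z * expi (- carg z) = (cabs z)%:C.
  by rewrite {1}[z]carg_polar -mulrA [expi (carg z) * _]mulrC expiN mulr1.
move: F0; rewrite /F [Z in _ *m Z](col2_eta x).
move: (y delta mu x 0 0) (y delta mu x 1 0) (col2_eta (y delta mu x)) => N n ->.
rewrite /X mul_mat2_col2 !mxE /= !mul0r addr0 add0r -/z => /eqP.
rewrite subr_eq0 => /eqP/matrixP F0.
have := F0 1 0; have := F0 0 0; rewrite !mxE /= => Fm Fp {F0}.
(* Both components are instances of one scalar identity: [c] is a diagonal entry
   of [X], [t] a coordinate of [x], and [q], [phi] are the polar coordinates of
   the injected component [v]. *)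
have key (t q c phi : R) (v : R[i]) : v = q%:C * expi phi ->
    c * t = rho * ((cabs z)^-1 * q) ->
    z * (expi (- carg z) * w * (c%:C * (t%:C * expi phi))) = rho%:C * w * v.
  move=> -> ct; rewrite [c%:C * _]mulrA -rmorphM ct.
  rewrite !mulrA ze !rmorphM /=.
  have zC0 : (cabs z)%:C != 0 :> R[i].
    by rewrite eq_complex /= eqxx andbT.
  by rewrite fmorphV; field.
apply/eqP; rewrite oppr_eq0 scaler_eq0 subr_eq0; apply/orP; right; apply/eqP.
rewrite -scalemxAr mul_mat2_col2 [in RHS](col2_eta uhat).
rewrite !mul0r addr0 add0r.
apply/matrixP => i k; rewrite !mxE /=.
case: ifP => _.
  by rewrite -(key _ _ _ _ _ um Fm) !(rmorphB, rmorph1).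
by rewrite -(key _ _ _ _ _ up Fp) rmorphB rmorphD rmorph1.
Qed.

Theorem theorem7 (R : realType) (kappa gamma delta alpha mu : R)
  (kappa_gt0 : 0 < kappa) (gamma_gt0 : 0 < gamma) (delta_gt0 : 0 < delta)
  (mu_gt1 : 1 < mu)
  (uhat : 'cV[R[i]]_2) (phim phip : R)
  (uhatm : uhat 0 0 = (cabs (uhat 0 0))%:C * expi phim)
  (uhatp : uhat 1 0 = (cabs (uhat 1 0))%:C * expi phip)
  (j : branch) (I : set R) (I_itv : is_interval I) (I0 : I 0)
  (h : R -> 'cV[R]_2)
  (h_sol : ivp_solution delta mu (rhat alpha uhat) (xpt delta mu j) I h)
  (lambda : R[i]) (lambda_neq0 : lambda <> 0) (I_lambda : I (cabs lambda)) :
  let theta := - carg (1 +i* alpha) in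
  let hl := h (cabs lambda) in
  let E := (expi theta * (lambda / (cabs lambda)%:C)) *:
             col2 ((hl 0 0)%:C * expi phim) ((hl 1 0)%:C * expi phip) in
  let Nn := y delta mu hl in
  equilibrium kappa gamma delta alpha mu (lambda *: uhat) E (Nn 0 0) (Nn 1 0).
Proof.
case: h_sol => detN0 dh h0 theta hl; rewrite {}/hl {}/theta.
have l0 : 0 < cabs lambda.
  rewrite lt0r cabs_eq0 (introN eqP lambda_neq0); case: (lambda) => a b.
  exact: sqrtr_ge0.
have lC0 : (cabs lambda)%:C != 0 :> R[i].
  by rewrite eq_complex /= eqxx andbT gt_eqF.
have hE := comp_solution_affine I_itv I0 I_lambda l0
  (fun x i => differentiable_F mu (rhat alpha uhat) 0 x i delta_gt0) detN0 dh.
rewrite h0 F_xpt// add0r subr0 in hE.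
have Fh0 : F delta mu (rhat alpha uhat) (cabs lambda) (h (cabs lambda)) = 0.
  by rewrite /F -hE /F scale0r subr0 subrr.
have w1 : cabs (lambda / (cabs lambda)%:C) = 1.
  rewrite /cabs ComplexField.Normc.normcM ComplexField.Normc.normcV.
  rewrite -!/(cabs _).
  have -> : cabs (cabs lambda)%:C = cabs lambda.
    by rewrite {1}/cabs /= expr0n addr0 sqrtr_sqr ger0_norm ?ltW.
  by rewrite divff ?gt_eqF.
have := equilibrium_of_F_eq0 kappa gamma delta_gt0 uhatm uhatp w1 Fh0.
by rewrite mulrCA divff// mulr1.
Qed.
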